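(* There is a sequence of fraction graphs $E_{a_n/b_n}$ (with $a_n,b_n$ positive integers and $a_n/b_n\ge2$) that is Cauchy in the asymptotic spectrum distance but does not converge, in the asymptotic spectrum distance, to any finite graph.
   Context: Graphs here are finite and simple. $E_n$ denotes the graph with $n$ vertices and no edges, $G\sqcup H$ the disjoint union, and $G\boxtimes H$ the strong product: its vertex set is $V(G)\times V(H)$, and distinct $(a,x),(b,y)$ are adjacent iff ($a=b$ or $\{a,b\}\in E(G)$) and ($x=y$ or $\{x,y\}\in E(H)$). A cohomomorphism $G\to H$ is a map $f:V(G)\to V(H)$ such that for all distinct non-adjacent $u,v\in V(G)$ the vertices $f(u),f(v)$ are distinct and non-adjacent in $H$. Write $G\le H$ if there is a cohomomorphism $G\to H$. The asymptotic spectrum of graphs $\mathcal X$ is the set of all maps $F$ from finite graphs to $\mathbb R_{\ge 0}$ with $F(G\sqcup H)=F(G)+F(H)$, $F(G\boxtimes H)=F(G)F(H)$, $F(E_n)=n$ for all $n\in\mathbb N$, and $G\le H\Rightarrow F(G)\le F(H)$. The asymptotic spectrum distance is $d(G,H)=\sup_{F\in\mathcal X}|F(G)-F(H)|$. Cauchy and convergent sequences are meant with respect to $d$ ($G_i$ converges to $H$ if $d(G_i,H)\to0$). For positive integers $p,q$ with $p/q\ge 2$, the fraction graph $E_{p/q}$ has vertex set $\{0,\dots,p-1\}$, and distinct $u,v$ are adjacent iff $u-v \bmod p<q$ or $v-u\bmod p<q$. *)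

(* Defs.v *)
(* Mathematical Components with MathComp-Analysis. *)
From mathcomp Require Import all_boot all_order all_algebra.
From mathcomp Require Import boolp classical_sets reals topology normedtype.

Set Implicit Arguments.
Unset Strict Implicit.
Unset Printing Implicit Defensive.

Import Order.TTheory GRing.Theory Num.Theory numFieldNormedType.Exports.

Local Open Scope classical_set_scope.
Local Open Scope ring_scope.

Record sgraph := SGraph {
  vert :> finType;
  adj : rel vert;
  adj_sym : symmetric adj;
  adj_irr : irreflexive adj }.

Section Constructions.

Lemma edgeless_sym n : symmetric (fun _ _ : 'I_n => false).
Proof. by []. Qed.

Lemma edgeless_irr n : irreflexive (fun _ _ : 'I_n => false).
Proof. by []. Qed.

Definition edgeless (n : nat) : sgraph :=
  SGraph (@edgeless_sym n) (@edgeless_irr n).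

Variables G H : sgraph.

Definition disjoint_union_adj : rel (G + H)%type := fun u v =>
  match u, v with
  | inl a, inl b => adj a b
  | inr x, inr y => adj x y
  | _, _ => false
  end.

Lemma disjoint_union_sym : symmetric disjoint_union_adj.
Proof. by case=> [a|x] [b|y] //=; rewrite adj_sym. Qed.

Lemma disjoint_union_irr : irreflexive disjoint_union_adj.
Proof. by case=> [a|x] /=; rewrite adj_irr. Qed.

Definition disjoint_union : sgraph :=
  SGraph disjoint_union_sym disjoint_union_irr.

Definition strong_product_adj : rel (G * H)%type := fun u v =>
  [&& u != v, (u.1 == v.1) || adj u.1 v.1 & (u.2 == v.2) || adj u.2 v.2].

Lemma strong_product_sym : symmetric strong_product_adj.
Proof.
move=> u v; rewrite /strong_product_adj.
by rewrite eq_sym (eq_sym u.1) (eq_sym u.2) (adj_sym u.1) (adj_sym u.2).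
Qed.

Lemma strong_product_irr : irreflexive strong_product_adj.
Proof. by move=> u; rewrite /strong_product_adj eqxx. Qed.

Definition strong_product : sgraph :=
  SGraph strong_product_sym strong_product_irr.

Definition cohomomorphism (f : G -> H) : Prop :=
  forall u v : G, u != v -> ~~ adj u v ->
    f u != f v /\ ~~ adj (f u) (f v).

Definition cohom_le : Prop := exists f : G -> H, cohomomorphism f.

End Constructions.

Section FractionGraph.

Variables p q : nat.

(* For u, v < p, the number (u + p - v) %% p is the residue of u - v mod p;
   adding p first avoids truncated subtraction. *)
Definition fraction_adj : rel 'I_p := fun u v =>
  (u != v) && (((u + p - v) %% p < q)%N || ((v + p - u) %% p < q)%N).

Lemma fraction_sym : symmetric fraction_adj.
Proof. by move=> u v; rewrite /fraction_adj eq_sym orbC. Qed.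

Lemma fraction_irr : irreflexive fraction_adj.
Proof. by move=> u; rewrite /fraction_adj eqxx. Qed.

Definition fraction_graph : sgraph := SGraph fraction_sym fraction_irr.

End FractionGraph.

Section AsymptoticSpectrum.

Variable R : realType.

(* A predicate rather than a set, since sgraph -> R is too large a type for the
   universe of classical_sets. *)
Record asymptotic_spectrum (F : sgraph -> R) : Prop := AsymptoticSpectrum {
  spectrum_ge0 : forall G, 0 <= F G;
  spectrum_union : forall G H, F (disjoint_union G H) = F G + F H;
  spectrum_product : forall G H, F (strong_product G H) = F G * F H;
  spectrum_edgeless : forall n, F (edgeless n) = n%:R;
  spectrum_mono : forall G H, cohom_le G H -> F G <= F H }.

(* The supremum is that of a bounded set (see spectrum_dist_ub); the spectrum
   is nonempty (it contains e.g. the fractional clique cover number), so the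
   convention sup set0 = 0 plays no role. *)
Definition spectrum_dist (G H : sgraph) : R :=
  sup [set x : R | exists2 F : sgraph -> R,
             asymptotic_spectrum F & x = `|F G - F H|].

Lemma spectrum_le_card F G : asymptotic_spectrum F -> F G <= #|G|%:R.
Proof.
move=> SF; rewrite -(spectrum_edgeless SF); apply: (spectrum_mono SF).
exists (@enum_rank G) => u v uv _; split=> //.
by apply: contra uv => /eqP/enum_rank_inj ->.
Qed.

Lemma spectrum_dist_ub G H :
  has_ubound [set x : R | exists2 F : sgraph -> R,
             asymptotic_spectrum F & x = `|F G - F H|].
Proof.
exists (#|G|%:R + #|H|%:R) => _ [F SF ->].
apply: (le_trans (ler_normB _ _)).
by rewrite !ger0_norm ?(spectrum_ge0 SF)// lerD ?spectrum_le_card.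
Qed.

Definition spectrum_cauchy (G : nat -> sgraph) : Prop :=
  forall e : R, 0 < e -> exists N : nat, forall m n : nat,
    (N <= m)%N -> (N <= n)%N -> spectrum_dist (G m) (G n) < e.

Definition spectrum_converges (G : nat -> sgraph) (H : sgraph) : Prop :=
  (fun n => spectrum_dist (G n) H) @ \oo --> (0 : R).

End AsymptoticSpectrum.

(* Main.v *)
Require Import Defs.
From mathcomp Require Import all_boot all_order all_algebra.
From mathcomp Require Import boolp classical_sets reals topology normedtype.
From mathcomp Require Import zify lra.

Import Order.TTheory GRing.Theory Num.Theory numFieldNormedType.Exports.

(** The limit of the sequence is prevented from existing by a single spectral
point, the fractional clique cover number [fcover_number]: it takes the value
[p / q] on [E_{p/q}] ([fcover_number_fraction]), and, there being only
countably many finite graphs up to isomorphism, it misses some real numbers of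
the interval [[2, 3]] on finite graphs.  So it suffices that fractions
decreasing to such a number give a Cauchy sequence.

The fractional clique cover number is defined as the infimum of the weights of
fractional covers by cliques.  That it is a spectral point
([fcover_number_spectrum]) is usually derived from linear programming duality;
here the only delicate part, supermultiplicativity, is obtained directly by
normalizing the slices of a cover of [G x H] into a cover of [H].

For the Cauchy property, call [a/b < p/q] Farey neighbours when
[p b = q a + 1].  Scaling by [a / p] and rounding down maps [E_{p/q}] minus a
vertex to [E_{a/b}], and by rotation the deleted vertex [c] is arbitrary
([farey_punctured_cohom]).  Given [n < p] and a tuple of [n] vertices, at least
one of [n + 1] fixed values of [c] does not occur in the tuple, so that the
[n]-th strong power of [E_{p/q}] is below [n + 1] copies of that of [E_{a/b}]
([power_cohom_le]).  Each spectral point [F] thus satisfies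
[F(E_{p/q})^n <= (n + 1) F(E_{a/b})^n]; taking [n]-th roots, [F(E_{p/q})] and
[F(E_{a/b})] are close, uniformly in [F], as soon as [p] is large
([spectrum_farey_gap], [small_gap_of_power_le]).

The sequence is made of the upper ends of nested intervals bounded by Farey
neighbours.  Each interval contains two disjoint such intervals with a larger
upper numerator ([refine_disjoint]), so the [n]-th step can avoid the
fractional clique cover number of the [n]-th finite graph
([avoiding_sep]).  The limit itself never has to be mentioned. *)

Local Open Scope ring_scope.

Set Implicit Arguments.
Unset Strict Implicit.

(** * Adjacency or equality *)

(** Cohomomorphisms are the maps that reflect this reflexive relation; unlike
    adjacency, it is a coordinatewise conjunction on strong products. *)
Definition adjeq (G : sgraph) : rel G := fun u v => (u == v) || adj u v.
Arguments adjeq {G}.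

Lemma adjeq_refl (G : sgraph) : reflexive (@adjeq G).
Proof. by move=> u; rewrite /adjeq eqxx. Qed.

Lemma adjeq_sym (G : sgraph) : symmetric (@adjeq G).
Proof. by move=> u v; rewrite /adjeq eq_sym adj_sym. Qed.

Lemma adjeq_cohomomorphism (G H : sgraph) (f : G -> H) :
  (forall u v, adjeq (f u) (f v) -> adjeq u v) -> cohomomorphism f.
Proof.
move=> nf u v uv nuv; apply/andP; rewrite -negb_or.
by apply: contra (nf u v) _; rewrite /adjeq negb_or uv.
Qed.

Lemma cohomomorphism_adjeq (G H : sgraph) (f : G -> H) u v :
  cohomomorphism f -> adjeq (f u) (f v) -> adjeq u v.
Proof.
move=> cf; apply: contraLR; rewrite !negb_or => /andP[uv nuv].
by apply/andP; exact: cf.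
Qed.

Lemma adjeq_product (G H : sgraph) (u v : strong_product G H) :
  adjeq u v = adjeq u.1 v.1 && adjeq u.2 v.2.
Proof.
rewrite {1}/adjeq /= /strong_product_adj; case: eqVneq => //= ->.
by rewrite !adjeq_refl.
Qed.

Lemma adjeq_union (G H : sgraph) (u v : disjoint_union G H) :
  adjeq u v = match u, v with
             | inl a, inl b => adjeq a b
             | inr x, inr y => adjeq x y
             | _, _ => false
             end.
Proof. by case: u v => [a|x] [b|y]. Qed.

Lemma adjeq_edgeless n (u v : edgeless n) : adjeq u v = (u == v).
Proof. by rewrite /adjeq orbF. Qed.

(** * Cohomomorphisms between fraction graphs *)

Lemma adjeq_fraction p q (u v : fraction_graph p q) : (0 < q)%N ->
  (v <= u)%N -> adjeq u v = (u - v < q)%N || (p - (u - v) < q)%N.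
Proof.
move=> q0 vu; have up : (u < p)%N := ltn_ord u.
rewrite /adjeq /= /fraction_adj; case: (eqVneq u v) => [->|uv] /=.
  by rewrite subnn q0.
have {}vu : (v < u)%N.
  by rewrite ltn_neqAle vu andbT; apply: contra uv => /eqP/val_inj ->.
have -> : ((u + p - v) %% p = u - v)%N.
  by rewrite -addnBAC 1?ltnW // modnDr modn_small //; lia.
by have -> : ((v + p - u) %% p = p - (u - v))%N;
  first by rewrite modn_small; lia.
Qed.

(** In the quotients [u * a %/ p], a gap [d] with [q <= d <= p - q] is scaled to
    [d * a / p], which lies in [[b, a - b]] up to the error [t / p]; rounding
    down then cannot leave [[b, a - b]] when both remainders are at least [t].
    The two cases of interest are [t = 0], where no vertex is excluded, and
    [t = 1], where only the vertex [0] is. *)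
Lemma floor_adjeq p q a b t (u v : fraction_graph p q)
    (u' v' : fraction_graph a b) :
  (0 < q)%N -> (0 < b)%N -> (b <= a)%N -> (p * b <= q * a + t)%N ->
  (u' : 'I_a) = ((u : 'I_p) * a %/ p)%N :> nat ->
  (v' : 'I_a) = ((v : 'I_p) * a %/ p)%N :> nat ->
  (t <= ((u : 'I_p) * a) %% p)%N -> (t <= ((v : 'I_p) * a) %% p)%N ->
  adjeq u' v' -> adjeq u v.
Proof.
move=> q0 b0 ba slope.
wlog vu : u v u' v' / ((v : 'I_p) <= (u : 'I_p))%N.
  move=> W; case: (leqP (v : 'I_p) (u : 'I_p)) => [|/ltnW] vu; first exact: W.
  by rewrite adjeq_sym [adjeq u v]adjeq_sym => eu ev tu tv; exact: W.
move=> eu ev tu tv; apply: contraLR.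
rewrite adjeq_fraction // negb_or -!leqNgt => /andP[qd dq].
have up : (u < p)%N := ltn_ord u.
have u'a := ltn_ord u'; have v'a := ltn_ord v'.
have p0 : (0 < p)%N by lia.
have Eu := divn_eq ((u : 'I_p) * a) p; have Ev := divn_eq ((v : 'I_p) * a) p.
have ru := ltn_pmod ((u : 'I_p) * a) p0.
have rv := ltn_pmod ((v : 'I_p) * a) p0.
rewrite -eu in Eu; rewrite -ev in Ev.
have vua : ((v : 'I_p) * a <= (u : 'I_p) * a)%N by rewrite leq_mul2r vu orbT.
have lower : ((v' : 'I_a) + b <= (u' : 'I_a))%N.
  suff : (((v' : 'I_a) + b) * p < ((u' : 'I_a).+1) * p)%N by rewrite ltn_pmul2r.
  have : (q * a <= ((u : 'I_p) - (v : 'I_p)) * a)%N by rewrite leq_mul2r qd orbT.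
  by rewrite mulnBl mulnDl mulSnr; have := mulnC p b; lia.
have upper : ((u' : 'I_a) - (v' : 'I_a) <= a - b)%N.
  suff : ((u' : 'I_a) * p < ((v' : 'I_a) + (a - b)).+1 * p)%N.
    by rewrite ltn_pmul2r //; lia.
  have : (((u : 'I_p) - (v : 'I_p)) * a <= (p - q) * a)%N.
    by rewrite leq_mul2r; lia.
  rewrite mulSnr mulnDl !mulnBl.
  have := mulnC p b; have := mulnC p a; have : (b * p <= a * p)%N.
    by rewrite leq_mul2r ba orbT.
  by lia.
by rewrite adjeq_fraction //; lia.
Qed.

Lemma fraction_cohom_le p q a b : (0 < q)%N -> (0 < b)%N -> (0 < p)%N ->
  (b <= a)%N -> (p * b <= a * q)%N ->
  cohom_le (fraction_graph p q) (fraction_graph a b).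
Proof.
move=> q0 b0 p0 ba pbaq.
have fa (u : 'I_p) : ((u * a) %/ p < a)%N.
  by rewrite ltn_divLR // mulnC ltn_pmul2l //; lia.
exists (fun u => Ordinal (fa u)); apply: adjeq_cohomomorphism => u v.
by apply: (@floor_adjeq p q a b 0) => //; rewrite addn0 [(q * a)%N]mulnC.
Qed.

(** The residue of [u - c] modulo [p], for [u, c < p], written without [modn] so
    that it is piecewise linear. *)
Definition cyc_sub p (c u : nat) : nat :=
  if (c <= u)%N then (u - c)%N else (u + p - c)%N.

Lemma adjeq_cyc_sub p q (c : 'I_p) (u v u' v' : fraction_graph p q) :
  (0 < q)%N ->
  (u' : 'I_p) = cyc_sub p c (u : 'I_p) :> nat ->
  (v' : 'I_p) = cyc_sub p c (v : 'I_p) :> nat ->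
  adjeq u' v' = adjeq u v.
Proof.
move=> q0; wlog vu : u v u' v' / ((v : 'I_p) <= (u : 'I_p))%N.
  move=> W; case: (leqP (v : 'I_p) (u : 'I_p)) => [|/ltnW] vu; first exact: W.
  by rewrite adjeq_sym [adjeq u v]adjeq_sym => eu ev; exact: W.
move=> eu ev; rewrite (adjeq_fraction q0 vu).
have := ltn_ord c; have := ltn_ord v; have := ltn_ord u; move: eu ev.
rewrite /cyc_sub => eu ev up vp cp.
move: eu ev; case: (leqP c (u : 'I_p)) => cu;
  case: (leqP c (v : 'I_p)) => cv eu ev; try lia.
- by rewrite adjeq_fraction ?eu ?ev //; lia.
- by rewrite adjeq_sym adjeq_fraction ?eu ?ev //; lia.
- by rewrite adjeq_fraction ?eu ?ev //; lia.
Qed.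

Lemma cyc_sub_lt p (c u : 'I_p) : (cyc_sub p c u < p)%N.
Proof.
rewrite /cyc_sub; have := ltn_ord u; have := ltn_ord c.
by case: (leqP c u); lia.
Qed.

(** Since [p] and [a] are coprime, the vertex [0] is the only one for which
    [u * a] has remainder [0] modulo [p], so rounding fails only there; rotating
    by [c] first moves the exception to the vertex [c]. *)
Lemma farey_punctured_cohom p q a b : (0 < q)%N -> (0 < b)%N ->
  (b <= a)%N -> (p * b = q * a + 1)%N ->
  exists f : 'I_p -> fraction_graph p q -> fraction_graph a b,
    forall (c : 'I_p) (u v : fraction_graph p q),
      u != c :> 'I_p -> v != c :> 'I_p ->
      adjeq (f c u) (f c v) -> adjeq u v.
Proof.
move=> q0 b0 ba pbqa; have p0 : (0 < p)%N by case: p pbqa => //; lia.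
have fa (u : 'I_p) : ((u * a) %/ p < a)%N.
  by rewrite ltn_divLR // mulnC ltn_pmul2l //; lia.
pose g (u : fraction_graph p q) : fraction_graph a b := Ordinal (fa u).
have cop : coprime p a.
  by rewrite /coprime -dvdn1 -(dvdn_addr 1 (dvdn_mull q (dvdn_gcdr p a))) -pbqa
    dvdn_mulr // dvdn_gcdl.
have r0 (u : 'I_p) : (0 < u)%N -> (0 < (u * a) %% p)%N.
  move=> u0; rewrite lt0n; apply/negP; rewrite -/(dvdn _ _) Gauss_dvdl //.
  by move/(dvdn_leq u0); have := ltn_ord u; lia.
have gP (u v : fraction_graph p q) : (0 < (u : 'I_p))%N -> (0 < (v : 'I_p))%N ->
    adjeq (g u) (g v) -> adjeq u v.
  move=> u0 v0; apply: (@floor_adjeq p q a b 1) => //; try exact: r0.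
  by rewrite pbqa.
exists (fun c u => g (Ordinal (cyc_sub_lt c u))) => c u v uc vc /gP.
rewrite (adjeq_cyc_sub (c := c) (u := u) (v := v)) //; apply; rewrite /= /cyc_sub.
- have : (u : 'I_p) != c :> nat by [].
  by have := ltn_ord u; have := ltn_ord c; case: (leqP c (u : 'I_p)); lia.
- have : (v : 'I_p) != c :> nat by [].
  by have := ltn_ord v; have := ltn_ord c; case: (leqP c (v : 'I_p)); lia.
Qed.

(** * Powers and maps with rare exceptions *)

Fixpoint strong_power (G : sgraph) (n : nat) : sgraph :=
  if n is k.+1 then strong_product G (strong_power G k) else edgeless 1.

Fixpoint power_map (G H : sgraph) (f : G -> H) n :
    strong_power G n -> strong_power H n :=
  match n with
  | 0 => id
  | k.+1 => fun x => (f x.1, power_map f x.2)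
  end.

Fixpoint hits (G : sgraph) (B : pred G) n : pred (strong_power G n) :=
  match n with
  | 0 => pred0
  | k.+1 => fun x => B x.1 || hits B x.2
  end.

Lemma adjeq_power_map (G H : sgraph) (f : G -> H) (B : pred G) :
  (forall u v, ~~ B u -> ~~ B v -> adjeq (f u) (f v) -> adjeq u v) ->
  forall n (x y : strong_power G n), ~~ hits B x -> ~~ hits B y ->
  adjeq (power_map f x) (power_map f y) -> adjeq x y.
Proof.
move=> fP; elim=> [|n IH] x y //= /norP[x1 x2] /norP[y1 y2].
rewrite !adjeq_product /= => /andP[n1 n2].
by apply/andP; split; [exact: fP n1|exact: IH n2].
Qed.

Lemma card_hits (G : sgraph) m (B : 'I_m -> pred G) :
  (forall u c d, B c u -> B d u -> c = d) ->
  forall n (x : strong_power G n), (#|[pred c | hits (B c) x]| <= n)%N.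
Proof.
move=> B1; elim=> [|n IH] x /=.
  by rewrite leqn0 (eq_card (B := pred0)) ?card0.
apply: (@leq_trans (#|[pred c | B c x.1]| + #|[pred c | hits (B c) x.2]|)).
  rewrite -cardUI; apply: leq_trans (leq_addr _ _).
  by apply: subset_leq_card; apply/fintype.subsetP => c.
apply: (@leq_add _ _ 1 n _ (IH x.2)).
by apply/card_le1_eqP => c d; rewrite !inE => Bc Bd; exact: (B1 x.1).
Qed.

(** A tuple [x] of [n] vertices is sent to a pair [(c, f c x)] such that [c] is
    one of the [n + 1] indices whose exceptional set [B c] is avoided by all the
    coordinates of [x].  The first component makes the choice of [c] harmless:
    two tuples with distinct choices get images that are distinct and
    non-adjacent. *)
Lemma power_cohom_le (G H : sgraph) n
    (f : 'I_n.+1 -> G -> H) (B : 'I_n.+1 -> pred G) :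
  (forall u c d, B c u -> B d u -> c = d) ->
  (forall c u v, ~~ B c u -> ~~ B c v -> adjeq (f c u) (f c v) -> adjeq u v) ->
  cohom_le (strong_power G n)
    (strong_product (edgeless n.+1) (strong_power H n)).
Proof.
move=> B1 fB.
have ex (x : strong_power G n) : exists c, ~~ hits (B c) x.
  apply/existsP; rewrite -negb_forall; apply/negP => /forallP hx.
  have := card_hits B1 x; rewrite (eq_card (B := 'I_n.+1)) ?card_ord ?ltnn //.
pose c x := xchoose (ex x).
pose F (x : strong_power G n) :
    strong_product (edgeless n.+1) (strong_power H n) :=
  (c x, power_map (f (c x)) x).
exists F; apply: adjeq_cohomomorphism => x y.
rewrite adjeq_product adjeq_edgeless /= => /andP[/eqP cxy].
have := xchooseP (ex x); rewrite -/(c x) => hx.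
have := xchooseP (ex y); rewrite -/(c y) -cxy => hy.
exact: adjeq_power_map (fB _) _ _ _ hx hy.
Qed.

(** * The fractional clique cover number *)

Section CliqueCover.
Variable R : realType.

(** The cliques are indexed by an arbitrary finite type rather than listed as
    sets of vertices: pulling back or projecting cliques then leaves the weights
    untouched, even when cliques get identified. *)
Record fractional_cover (G : sgraph) (I : finType)
    (w : I -> R) (K : I -> pred G) : Prop :=
  FractionalCover {
    cover_ge0 : forall i, 0 <= w i;
    cover_clique : forall i u v, K i u -> K i v -> adjeq u v;
    cover_covers : forall v, 1 <= \sum_(i | K i v) w i }.

Definition cover_weights (G : sgraph) : set R :=
  fun x => exists (I : finType) (w : I -> R) (K : I -> pred G),
    fractional_cover w K /\ x = \sum_i w i.

Definition fcover_number (G : sgraph) : R := inf (cover_weights G).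

Lemma cover_weights_lb G : lbound (cover_weights G) 0.
Proof.
move=> _ [I [w [K [c ->]]]]; apply: sumr_ge0 => i _.
exact: cover_ge0 c i.
Qed.

Lemma cover_weights_neq0 G : (cover_weights G !=set0)%classic.
Proof.
exists (\sum_(i : G) 1), G, (fun=> 1), (fun i v => i == v); split=> //; split=> //.
- by move=> i u v /eqP <- /eqP <-; exact: adjeq_refl.
- by move=> v; rewrite (big_pred1 v).
Qed.

Lemma fcover_number_le_weight (G : sgraph) (I : finType)
    (w : I -> R) (K : I -> pred G) :
  fractional_cover w K -> fcover_number G <= \sum_i w i.
Proof.
move=> c; apply: ge_inf; first by exists 0; exact: cover_weights_lb.
by exists I, w, K.
Qed.

Lemma fcover_number_ge0 G : 0 <= fcover_number G.
Proof.
by apply: lb_le_inf; [exact: cover_weights_neq0|exact: cover_weights_lb].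
Qed.

Lemma le_mul_fcover_number (G : sgraph) c r : 0 <= c ->
  (forall (I : finType) (w : I -> R) (K : I -> pred G),
     fractional_cover w K -> r <= c * \sum_i w i) ->
  r <= c * fcover_number G.
Proof.
move=> c0 rP; have [c0'|cn0] := eqVneq c 0.
  have [_ [I [w [K [cov _]]]]] := cover_weights_neq0 G.
  by have := rP _ _ _ cov; rewrite c0' !mul0r.
have cp : 0 < c by rewrite lt0r cn0.
rewrite mulrC -ler_pdivrMr //; apply: lb_le_inf; first exact: cover_weights_neq0.
move=> _ [I [w [K [cov ->]]]]; rewrite ler_pdivrMr // mulrC; exact: rP cov.
Qed.

Lemma le_add_fcover_number (G : sgraph) c r :
  (forall (I : finType) (w : I -> R) (K : I -> pred G),
     fractional_cover w K -> r <= c + \sum_i w i) ->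
  r <= c + fcover_number G.
Proof.
move=> rP; rewrite -lerBlDl; apply: lb_le_inf; first exact: cover_weights_neq0.
move=> _ [I [w [K [cov ->]]]]; rewrite lerBlDl; exact: rP cov.
Qed.

Lemma fcover_number_mono G H : cohom_le G H -> fcover_number G <= fcover_number H.
Proof.
move=> [f cf]; rewrite -[leRHS]mul1r; apply: le_mul_fcover_number => // I w K c.
rewrite mul1r; apply: (@fcover_number_le_weight _ _ _ (fun i v => K i (f v))).
split; [exact: cover_ge0 c| |by move=> v; exact: cover_covers c (f v)].
by move=> i u v Ku Kv; apply: (cohomomorphism_adjeq cf);
  exact: cover_clique c i _ _ Ku Kv.
Qed.

(** A clique of a disjoint union lies on one side, so its weight is counted for
    one of the two graphs only. *)
Lemma fcover_number_union G H : fcover_number (disjoint_union G H) =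
  fcover_number G + fcover_number H.
Proof.
apply/eqP; rewrite eq_le; apply/andP; split.
  apply: le_add_fcover_number => J z L cH; rewrite addrC.
  apply: le_add_fcover_number => I w K cG.
  pose wz (k : I + J) := match k with inl i => w i | inr j => z j end.
  pose KL (k : I + J) : pred (disjoint_union G H) := fun u =>
    match k, u with
    | inl i, inl a => K i a
    | inr j, inr x => L j x
    | _, _ => false
    end.
  have -> : \sum_j z j + \sum_i w i = \sum_k wz k by rewrite big_sumType addrC.
  apply: (@fcover_number_le_weight _ _ _ KL); split.
  - by case=> [i|j]; [exact: cover_ge0 cG i|exact: cover_ge0 cH j].
  - move=> [i|j] [a|x] [b|y] //= hu hv; rewrite adjeq_union.
      exact: cover_clique cG _ _ _ hu hv.
    exact: cover_clique cH _ _ _ hu hv.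
  - move=> [a|x]; rewrite big_sumType /=.
      by rewrite [X in _ + X]big_pred0 // addr0; exact: cover_covers cG a.
    by rewrite [X in X + _]big_pred0 // add0r; exact: cover_covers cH x.
rewrite -[leRHS]mul1r; apply: le_mul_fcover_number => // I w K c; rewrite mul1r.
pose P i := [exists a, K i (inl a)]; pose Q i := [exists x, K i (inr x)].
have PQ i : P i -> Q i -> False.
  move=> /existsP[a Ka] /existsP[x Kx].
  by have := cover_clique c Ka Kx; rewrite adjeq_union.
have cG : fractional_cover (fun i => w i *+ P i) (fun i a => K i (inl a)).
  split.
  - by move=> i; rewrite mulrn_wge0 // (cover_ge0 c).
  - by move=> i a b Ka Kb; have := cover_clique c Ka Kb; rewrite adjeq_union.
  - move=> a; apply: le_trans (cover_covers c (inl a)) _.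
    by apply: ler_sum => i Ka; have -> : P i by apply/existsP; exists a.
have cH : fractional_cover (fun i => w i *+ Q i) (fun i a => K i (inr a)).
  split.
  - by move=> i; rewrite mulrn_wge0 // (cover_ge0 c).
  - by move=> i a b Ka Kb; have := cover_clique c Ka Kb; rewrite adjeq_union.
  - move=> a; apply: le_trans (cover_covers c (inr a)) _.
    by apply: ler_sum => i Ka; have -> : Q i by apply/existsP; exists a.
apply: le_trans (lerD (fcover_number_le_weight cG)
  (fcover_number_le_weight cH)) _.
rewrite -big_split /=; apply: ler_sum => i _.
have := PQ i; have := cover_ge0 c i.
by case: (P i); case: (Q i) => //= w0 PQi; rewrite ?addr0 ?add0r //; case: PQi.
Qed.

(** Products of cliques give one inequality.  For the other, let [(w, K)] be a
    cover of the product.  For each vertex [x] of [H], the cliques that meet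
    [G x {x}] form, once projected, a cover of [G], hence have total weight at
    least the number of [G].  So the projections of the [K i] to [H], with
    weights [w i] divided by that number, cover [H]. *)
Lemma fcover_number_product G H : fcover_number (strong_product G H) =
  fcover_number G * fcover_number H.
Proof.
apply/eqP; rewrite eq_le; apply/andP; split.
  apply: le_mul_fcover_number => [|J z L cH]; first exact: fcover_number_ge0.
  rewrite mulrC; apply: le_mul_fcover_number => [|I w K cG].
    by apply: sumr_ge0 => j _; exact: cover_ge0 cH j.
  pose wz (k : I * J) := w k.1 * z k.2.
  pose KL (k : I * J) : pred (strong_product G H) :=
    fun u => K k.1 u.1 && L k.2 u.2.
  have -> : (\sum_j z j) * (\sum_i w i) = \sum_k wz k.
    by rewrite mulrC big_distrlr pair_big.
  apply: (@fcover_number_le_weight _ _ _ KL); split.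
  - by move=> k; rewrite mulr_ge0 ?(cover_ge0 cG) ?(cover_ge0 cH).
  - move=> k u v /andP[Ku Lu] /andP[Kv Lv]; rewrite adjeq_product.
    by rewrite (cover_clique cG Ku Kv) (cover_clique cH Lu Lv).
  - move=> u; rewrite -(pair_big (fun i => K i u.1) (fun j => L j u.2)
      (fun i j => w i * z j)) /=.
    rewrite -big_distrlr -[1]mulr1 /=.
    by rewrite ler_pM ?ler01 ?(cover_covers cG) ?(cover_covers cH).
rewrite -[leRHS]mul1r; apply: le_mul_fcover_number => // I w K c; rewrite mul1r.
have w0 := cover_ge0 c.
have [->|rG] := eqVneq (fcover_number G) 0; first by rewrite mul0r sumr_ge0.
have rp : 0 < fcover_number G by rewrite lt0r rG fcover_number_ge0.
pose K2 i : pred H := fun x => [exists a, K i (a, x)].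
have cH : fractional_cover (fun i => w i / fcover_number G) K2.
  split.
  - by move=> i; rewrite divr_ge0 ?(ltW rp).
  - move=> i x y /existsP[a Ka] /existsP[b Kb].
    by have := cover_clique c Ka Kb; rewrite adjeq_product => /andP[].
  - move=> x; rewrite -mulr_suml ler_pdivlMr // mul1r big_mkcond /=.
    apply: (@fcover_number_le_weight _ _ _ (fun i a => K i (a, x))); split.
    + by move=> i; case: ifP.
    + move=> i a b Ka Kb.
      by have := cover_clique c Ka Kb; rewrite adjeq_product => /andP[].
    + move=> a; apply: le_trans (cover_covers c (a, x)) _.
      by apply: ler_sum => i Ka; have -> : K2 i x by apply/existsP; exists a.
by have := fcover_number_le_weight cH; rewrite -mulr_suml ler_pdivlMr // mulrC.
Qed.

(** Double counting of the weighted pairs (vertex, clique that contains it). *)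
Lemma card_le_fcover_number (G : sgraph) q :
  (forall K : pred G, (forall u v, K u -> K v -> adjeq u v) -> (#|K| <= q)%N) ->
  #|G|%:R <= q%:R * fcover_number G.
Proof.
move=> Kq; apply: le_mul_fcover_number => // I w K c.
apply: (@le_trans _ _ (\sum_(v : G) \sum_(i | K i v) w i)).
  by rewrite -sumr_const; apply: ler_sum => v _; exact: cover_covers c v.
rewrite (exchange_big_dep xpredT) //= mulr_sumr; apply: ler_sum => i _.
rewrite sumr_const -[leLHS]mulr_natl ler_wpM2r ?(cover_ge0 c) // ler_nat.
apply: (Kq (K i)) => u v Ku Kv; exact: (cover_clique c Ku Kv).
Qed.

Lemma fcover_number_edgeless n : fcover_number (edgeless n) = n%:R.
Proof.
apply/eqP; rewrite eq_le; apply/andP; split.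
  have c : fractional_cover (G := edgeless n)
      (fun _ : 'I_n => 1) (fun i v => i == v).
    split=> //.
    - by move=> i u v /eqP <- /eqP <-; exact: adjeq_refl.
    - by move=> v; rewrite (big_pred1 v).
  by have := fcover_number_le_weight c; rewrite sumr_const card_ord.
have := @card_le_fcover_number (edgeless n) 1; rewrite card_ord mul1r; apply=> K cK.
by apply/card_le1_eqP => u v Ku Kv; apply/eqP; rewrite -adjeq_edgeless; exact: cK.
Qed.

Lemma fcover_number_spectrum : asymptotic_spectrum fcover_number.
Proof.
split.
- exact: fcover_number_ge0.
- exact: fcover_number_union.
- exact: fcover_number_product.
- exact: fcover_number_edgeless.
- exact: fcover_number_mono.
Qed.

(** Relative to one of its vertices, a clique lives in the residues [[0, q)] and
    [(p - q, p)].  The residues [r] and [p - q + r] are distinct and non-adjacent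
    as [2 q <= p], so identifying them maps the clique injectively to
    [[0, q)]. *)
Lemma card_fraction_clique p q (K : pred (fraction_graph p q)) : (0 < q)%N ->
  (q.*2 <= p)%N -> (forall u v, K u -> K v -> adjeq u v) -> (#|K| <= q)%N.
Proof.
case: q K => // q K _ qp cK; have [c Kc|K0] := pickP K;
  last by rewrite (eq_card0 K0).
have rl := @cyc_sub_lt p c.
pose d (u : 'I_p) : nat :=
  if (cyc_sub p c u < q.+1)%N then cyc_sub p c u
  else (cyc_sub p c u - (p - q.+1))%N.
have adjeq0 (u : fraction_graph p q.+1) : K u ->
    (cyc_sub p c (u : 'I_p) < q.+1)%N || (p - cyc_sub p c (u : 'I_p) < q.+1)%N.
  move=> Ku; have p0 : (0 < p)%N by lia.
  have := cK _ _ Ku Kc.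
  rewrite -(@adjeq_cyc_sub p q.+1 c u c (Ordinal (rl u)) (Ordinal p0)) //=;
    last by rewrite /cyc_sub leqnn subnn.
  by rewrite adjeq_fraction //= subn0.
have dq u : K u -> (d u < q.+1)%N.
  by move=> /adjeq0; rewrite /d; have := rl u;
    case: (ltnP (cyc_sub p c u) q.+1); lia.
have inj : {in K &, injective (fun u => inord (d u) : 'I_q.+1)}.
  move=> u v Ku Kv /(congr1 val) /=; rewrite !inordK ?dq // => duv.
  have := cK _ _ Ku Kv.
  have := adjeq0 _ Ku; have := adjeq0 _ Kv.
  have E (x y : 'I_p) : cyc_sub p c x = cyc_sub p c y -> x = y.
    move=> h; apply: val_inj => /=; have := ltn_ord x; have := ltn_ord y.
    have := ltn_ord c; move: h; rewrite /cyc_sub.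
    by case: (leqP c x); case: (leqP c y); lia.
  rewrite -(@adjeq_cyc_sub p q.+1 c u v (Ordinal (rl u)) (Ordinal (rl v))) //.
  move=> Nv Nu N; apply: E; move: duv Nv Nu N (rl u) (rl v); rewrite /d.
  move: (cyc_sub p c u) (cyc_sub p c v) (rl u) (rl v) => x y xp yp.
  have [xy|/ltnW xy] := leqP y x; last rewrite adjeq_sym.
    by rewrite adjeq_fraction //=; case: (ltnP x q.+1); case: (ltnP y q.+1); lia.
  by rewrite adjeq_fraction //=; case: (ltnP x q.+1); case: (ltnP y q.+1); lia.
by have := @leq_card_in (fraction_graph p q.+1) _ _ _ inj; rewrite card_ord.
Qed.

(** The upper bound comes from the [p] cyclic intervals of length [q], each with
    weight [1 / q]. *)
Lemma fcover_number_fraction p q : (0 < q)%N -> (q.*2 <= p)%N ->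
  fcover_number (fraction_graph p q) = p%:R / q%:R.
Proof.
move=> q0 qp; have qR : 0 < q%:R :> R by rewrite ltr0n.
have p0 : (0 < p)%N by lia.
apply/eqP; rewrite eq_le; apply/andP; split; last first.
  rewrite ler_pdivrMr // mulrC -[p in p%:R]card_ord.
  by apply: (@card_le_fcover_number (fraction_graph p q)) => K; exact: card_fraction_clique.
pose K (i : 'I_p) : pred (fraction_graph p q) :=
  fun v => (cyc_sub p i (v : 'I_p) < q)%N.
have c : fractional_cover (fun _ : 'I_p => q%:R^-1) K.
  split.
  - by move=> _; rewrite invr_ge0 ltW.
  - move=> i u v; rewrite /K => Ku Kv.
    rewrite -(@adjeq_cyc_sub p q i u v (Ordinal (cyc_sub_lt i u))
      (Ordinal (cyc_sub_lt i v))) //.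
    have [vu|/ltnW uv] := leqP (cyc_sub p i (v : 'I_p)) (cyc_sub p i (u : 'I_p)).
      by rewrite adjeq_fraction //=; lia.
    by rewrite adjeq_sym adjeq_fraction //=; lia.
  - move=> v; rewrite sumr_const -[leRHS]mulr_natl ler_pdivlMr // mul1r ler_nat.
    have vp : (v < p)%N := ltn_ord v.
    have rl (j : 'I_q) : (cyc_sub p j v < p)%N.
      by rewrite /cyc_sub; have := ltn_ord j; case: (leqP j v); lia.
    have inj : injective (fun j => Ordinal (rl j)).
      move=> j k /(congr1 val) /=; rewrite /cyc_sub => h; apply: val_inj => /=.
      move: h; have := ltn_ord j; have := ltn_ord k.
      by case: (leqP j v); case: (leqP k v); lia.
    rewrite -[leqLHS]card_ord -(card_codom inj).
    apply: subset_leq_card; apply/fintype.subsetP => _ /codomP[j ->].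
    rewrite unfold_in /K /cyc_sub /=; have jq := ltn_ord j.
    case: (leqP j v) => jv; first by rewrite leq_subr; lia.
    by have -> : (v + p - j <= v)%N = false; lia.
by have := fcover_number_le_weight c; rewrite sumr_const card_ord
  -[X in _ <= X]mulr_natl.
Qed.

End CliqueCover.

(** * Uniform closeness at Farey neighbours *)

Lemma ratio_le (R : realType) a b c d : (0 < b)%N -> (0 < d)%N ->
  (a%:R / b%:R <= c%:R / d%:R :> R) = (a * d <= c * b)%N.
Proof.
move=> b0 d0; rewrite ler_pdivrMr ?ltr0n // mulrAC ler_pdivlMr ?ltr0n //.
by rewrite -!natrM ler_nat.
Qed.

Section SpectralPoints.
Variable R : realType.
Variable F : sgraph -> R.
Hypothesis SF : asymptotic_spectrum F.

Lemma spectrum_power G n : F (strong_power G n) = F G ^+ n.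
Proof.
elim: n => [|n IH] /=; first by rewrite (spectrum_edgeless SF) expr0.
by rewrite (spectrum_product SF) IH exprS.
Qed.

Lemma spectrum_fraction_le p q a b : (0 < q)%N -> (0 < b)%N -> (0 < p)%N ->
  (b <= a)%N -> p%:R / q%:R <= a%:R / b%:R :> R ->
  F (fraction_graph p q) <= F (fraction_graph a b).
Proof.
move=> q0 b0 p0 ba pqab; apply: (spectrum_mono SF); apply: fraction_cohom_le => //.
by move: pqab; rewrite ratio_le.
Qed.

Lemma spectrum_fraction_le_nat p q k :
  (0 < q)%N -> (0 < p)%N -> (0 < k)%N -> (p <= k * q)%N ->
  F (fraction_graph p q) <= k%:R.
Proof.
move=> q0 p0 k0 pq; rewrite -(spectrum_edgeless SF); apply: (spectrum_mono SF).
have [f fP] : cohom_le (fraction_graph p q) (fraction_graph k 1).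
  by apply: fraction_cohom_le => //; rewrite muln1.
exists f; apply: adjeq_cohomomorphism => u v; rewrite adjeq_edgeless => /eqP fuv.
by apply: (cohomomorphism_adjeq fP); rewrite fuv adjeq_refl.
Qed.

Lemma spectrum_ge1 (G : sgraph) : G -> 1 <= F G.
Proof.
move=> g; rewrite -[1]/(1%:R) -(spectrum_edgeless SF); apply: (spectrum_mono SF).
by exists (fun=> g); apply: adjeq_cohomomorphism => u v _; rewrite !ord1 adjeq_refl.
Qed.

Lemma spectrum_farey_gap p q a b n : (0 < q)%N -> (0 < b)%N -> (b <= a)%N ->
  (p * b = q * a + 1)%N -> (n < p)%N ->
  F (fraction_graph p q) ^+ n <= n.+1%:R * F (fraction_graph a b) ^+ n.
Proof.
move=> q0 b0 ba pbqa np.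
rewrite -!spectrum_power -(spectrum_edgeless SF) -(spectrum_product SF).
apply: (spectrum_mono SF); have [f fP] := farey_punctured_cohom q0 b0 ba pbqa.
pose w := widen_ord np.
apply: (@power_cohom_le _ _ _ (fun c => f (w c))
  (fun c u => (u : 'I_p) == w c)).
  move=> u c d /eqP uc /eqP ud; apply: val_inj.
  by have := congr1 val uc; rewrite ud.
by move=> c u v; exact: fP.
Qed.

End SpectralPoints.

(** With [n = 2 k] and [d = e / 3], an excess [y + e <= x] would give
    [x >= y (1 + d)], and [(1 + d)^(2 k) >= (1 + k d)^2 > 1 + 2 k] once
    [k d^2 > 2]. *)
Lemma small_gap_of_power_le (R : realType) (e : R) : 0 < e ->
  exists n : nat, forall x y : R, 1 <= y -> y <= 3 ->
    x ^+ n <= n.+1%:R * y ^+ n -> x < y + e.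
Proof.
move=> e0; have [d dE d0] : exists2 d, d = e / 3 & 0 < d
  by exists (e / 3); rewrite ?divr_gt0.
pose k := Num.bound (2 / d ^+ 2).
have kd : 2 < k%:R * d ^+ 2.
  rewrite -ltr_pdivrMr ?exprn_gt0 //; apply: archi_boundP.
  by rewrite divr_ge0 // exprn_ge0 // ltW.
have k0 : 0 < k%:R :> R.
  by have d2 := exprn_gt0 2 d0; rewrite -(pmulr_lgt0 _ d2); lra.
exists (k * 2)%N => x y y1 y3; apply: contraTT; rewrite -leNgt -ltNge => yx.
have bern : forall n, 1 + n%:R * d <= (1 + d) ^+ n.
  elim=> [|n IH]; first by rewrite expr0; lra.
  have d1 : 0 <= 1 + d by lra.
  rewrite exprS -natr1; apply: le_trans (ler_wpM2l d1 IH).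
  have : 0 <= n%:R * d * d :> R by rewrite !mulr_ge0 // ltW.
  by lra.
have yd : y * (1 + d) <= x.
  by apply: le_trans yx; rewrite mulrDr mulr1 lerD2l dE; nra.
have yp : 0 < y by lra.
apply: (@lt_le_trans _ _ ((y * (1 + d)) ^+ (k * 2))); last first.
  have y1d : 0 <= y * (1 + d) by apply: mulr_ge0; lra.
  by apply: lerXn2r; rewrite // nnegrE // (le_trans y1d).
rewrite exprMn mulrC ltr_pM2l ?exprn_gt0 // exprM.
apply: (@lt_le_trans _ _ ((1 + k%:R * d) ^+ 2)); last first.
  have h := mulr_gt0 k0 d0.
  by apply: lerXn2r; rewrite ?bern // nnegrE ?exprn_ge0 //; lra.
have h := mulr_gt0 k0 d0.
have : k%:R * 2 < k%:R * (k%:R * d ^+ 2) by rewrite ltr_pM2l.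
rewrite -[(k * 2).+1%:R]natr1 natrM !expr2; lra.
Qed.

(** * Enumeration of the finite graphs *)

Definition graph_code := {n : nat & {set 'I_n * 'I_n}}.

Section Decode.
Variable c : graph_code.

(** Arbitrary sets of pairs are symmetrized and stripped of their diagonal, so
    that every code denotes a graph. *)
Definition decode_adj : rel 'I_(tag c) := fun i j =>
  (i != j) && (((i, j) \in tagged c) || ((j, i) \in tagged c)).

Lemma decode_sym : symmetric decode_adj.
Proof. by move=> i j; rewrite /decode_adj eq_sym orbC. Qed.

Lemma decode_irr : irreflexive decode_adj.
Proof. by move=> i; rewrite /decode_adj eqxx. Qed.

Definition decode : sgraph := SGraph decode_sym decode_irr.
End Decode.

(** Mutual domination is all that is needed of an isomorphism: every spectral
    point then takes the same value on both graphs. *)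
Lemma decode_surj (H : sgraph) :
  exists c, cohom_le H (decode c) /\ cohom_le (decode c) H.
Proof.
pose S : {set 'I_#|H| * 'I_#|H|} :=
  [set ij | adj (enum_val ij.1 : H) (enum_val ij.2 : H)]%SET.
pose c : graph_code := Tagged (fun n => {set 'I_n * 'I_n}) S; exists c.
have E (i j : 'I_#|H|) : adjeq (i : decode c) j
    = adjeq (enum_val i : H) (enum_val j : H).
  rewrite /adjeq /= /decode_adj /= !inE /= [adj (enum_val j) _]adj_sym orbb.
  by rewrite (inj_eq enum_val_inj); case: eqVneq.
split.
  exists (@enum_rank H : H -> decode c).
  by apply: adjeq_cohomomorphism => u v; rewrite E !enum_rankK.
exists (fun i : decode c => enum_val (i : 'I_#|H|) : H).
by apply: adjeq_cohomomorphism => u v; rewrite -E.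
Qed.

(** * Nested Farey intervals *)

Record farey_pair := FareyPair {
  lo_num : nat; lo_den : nat; hi_num : nat; hi_den : nat }.

Definition farey (s : farey_pair) : Prop :=
  let: FareyPair a b p q := s in
  [/\ (0 < b)%N, (0 < q)%N, (b.*2 <= a)%N, (p <= 3 * q)%N
    & (p * b = q * a + 1)%N].

(** The left part ends at [(2a + p) / (2b + q)], the right part joins the
    mediant [(a + p) / (b + q)] to [(a + 2p) / (b + 2q)].  Both have an upper
    numerator larger than [p]; with [p / q] itself as an upper end it could stay
    constant, and the bound on the gap of spectral points across the interval
    would not tend to [0]. *)
Definition refine (left : bool) (s : farey_pair) : farey_pair :=
  let: FareyPair a b p q := s in
  if left then FareyPair a b (a.*2 + p) (b.*2 + q)
  else FareyPair (a + p) (b + q) (a + p.*2) (b + q.*2).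

Lemma farey_refine l s : farey s -> farey (refine l s).
Proof.
case: s => a b p q [b0 q0 ba pq det].
have qp : (q.*2 <= p)%N by nia.
by case: l; split=> /=; nia.
Qed.

Lemma farey_hi s : farey s -> ((hi_den s).*2 <= hi_num s)%N.
Proof. by case: s => a b p q [b0 q0 ba pq det] /=; nia. Qed.

Section FareyIntervals.
Variable R : realType.

Definition lo s : R := (lo_num s)%:R / (lo_den s)%:R.
Definition hi s : R := (hi_num s)%:R / (hi_den s)%:R.

Lemma farey_lo_hi s : farey s -> lo s <= hi s.
Proof.
case: s => a b p q [b0 q0 ba pq det].
by rewrite /lo /hi ratio_le //=; nia.
Qed.

Lemma refine_nested l s : farey s ->
  lo s <= lo (refine l s) /\ hi (refine l s) <= hi s.
Proof.
case: s => a b p q [b0 q0 ba pq det].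
by case: l; rewrite /lo /hi /= !ratio_le; (try split); nia.
Qed.

Lemma refine_disjoint s : farey s -> hi (refine true s) < lo (refine false s).
Proof.
case: s => a b p q [b0 q0 ba pq det].
by rewrite /lo /hi /= ltNge ratio_le; nia.
Qed.

Variable x : nat -> R.

(** The left part is chosen when [x k] lies strictly above it; otherwise [x k]
    lies strictly below the right part. *)
Fixpoint avoiding (n : nat) : farey_pair :=
  if n is k.+1 then
    let s := avoiding k in refine (hi (refine true s) < x k) s
  else FareyPair 2 1 3 1.

Lemma avoiding_farey n : farey (avoiding n).
Proof. by elim: n => [|n IH] //=; exact: farey_refine. Qed.

Lemma avoiding_hi_num n : (n <= hi_num (avoiding n))%N.
Proof.
elim: n => [|n IH] //=; have := avoiding_farey n.
by case: (avoiding n) IH => a b p q /= np [b0 q0 ba pq det];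
  case: ifP => _ /=; nia.
Qed.

Lemma avoiding_nested m n : (m <= n)%N ->
  lo (avoiding m) <= lo (avoiding n) /\ hi (avoiding n) <= hi (avoiding m).
Proof.
move=> /subnK <-; elim: (n - m)%N => [|k [IHl IHh]] //.
rewrite addSn /=; set l := _ < _.
have [l1 h1] := refine_nested l (avoiding_farey (k + m)).
by split; [exact: le_trans l1|exact: le_trans h1 _].
Qed.

Lemma avoiding_sep n : x n < lo (avoiding n.+1) \/ hi (avoiding n.+1) < x n.
Proof.
rewrite /=; set s := avoiding n.
case: (ltP (hi (refine true s)) (x n)) => h; [by right|left].
exact: le_lt_trans h (refine_disjoint (avoiding_farey n)).
Qed.

End FareyIntervals.

(** * The sequence *)

Lemma spectrum_dist_ge (R : realType) (F : sgraph -> R) G H :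
  asymptotic_spectrum F -> `|F G - F H| <= spectrum_dist R G H.
Proof.
by move=> SF; apply: ub_le_sup; [exact: spectrum_dist_ub|exists F].
Qed.

Lemma spectrum_dist_le (R : realType) (e : R) G H :
  (forall F, asymptotic_spectrum F -> `|F G - F H| <= e) ->
  spectrum_dist R G H <= e.
Proof.
move=> Fe; apply: ge_sup.
  exists `|fcover_number R G - fcover_number R H|, (fcover_number R) => //.
  exact: fcover_number_spectrum.
by move=> _ [F SF ->]; exact: Fe.
Qed.

Theorem corollary3p16 (R : realType) :
  exists a b : nat -> nat,
    (forall n : nat,
       [/\ (0 < a n)%N, (0 < b n)%N & 2 <= (a n)%:R / (b n)%:R :> R]) /\
    spectrum_cauchy R (fun n => fraction_graph (a n) (b n)) /\
    (forall H : sgraph,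
       ~ spectrum_converges R (fun n => fraction_graph (a n) (b n)) H).
Proof.
pose x n : R := if unpickle n is Some c then fcover_number R (decode c) else 0.
pose s := avoiding x; exists (fun n => hi_num (s n)), (fun n => hi_den (s n)).
have sF n : farey (s n) := avoiding_farey x n.
have pos n : (0 < lo_den (s n))%N /\ (0 < hi_den (s n))%N.
  by have := sF n; case: (s n) => ? ? ? ? [].
have hi2 n := farey_hi (sF n).
have lo2 n : (lo_den (s n) <= lo_num (s n))%N /\
    (lo_num (s n) <= 3 * lo_den (s n))%N.
  by have := sF n; case: (s n) => a b p q [b0 q0 ba pq det] /=; nia.
have nested m n : (m <= n)%N ->
    lo R (s m) <= hi R (s n) /\ hi R (s n) <= hi R (s m).
  move=> mn; have [l h] := avoiding_nested x mn; split=> //.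
  exact: le_trans l (farey_lo_hi R (sF n)).
split; [|split].
- move=> n; have [_ q0] := pos n; split=> //; first by have := hi2 n; lia.
  by rewrite ler_pdivlMr ?ltr0n // -natrM ler_nat mul2n.
- (* Spectral points are monotone on fractions, so from rank [N + 1] on the values
     lie between those at the two ends of the interval of rank [N + 1], whose
     upper numerator exceeds the exponent [N]. *)
  move=> e e0; have e20 : 0 < e / 2 by rewrite divr_gt0.
  have [N NP] := small_gap_of_power_le e20; exists N.+1 => m n mN nN.
  apply: (@le_lt_trans _ _ (e / 2)); last by rewrite ltr_pdivrMr //; lra.
  apply: spectrum_dist_le => F SF.
  have [bN qN] := pos N.+1; have [l2 l3] := lo2 N.+1; have h2 := hi2 N.+1.
  have gap : F (fraction_graph (hi_num (s N.+1)) (hi_den (s N.+1)))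
      < F (fraction_graph (lo_num (s N.+1)) (lo_den (s N.+1))) + e / 2.
    have a0 : (0 < lo_num (s N.+1))%N by lia.
    apply: NP.
    + by apply: (spectrum_ge1 SF); exact: Ordinal a0.
    + exact: (spectrum_fraction_le_nat SF).
    + apply: (spectrum_farey_gap SF) => //; last exact: avoiding_hi_num.
      by have := sF N.+1; case: (s N.+1) => ? ? ? ? [].
  have between k : (N.+1 <= k)%N ->
      F (fraction_graph (lo_num (s N.+1)) (lo_den (s N.+1)))
        <= F (fraction_graph (hi_num (s k)) (hi_den (s k))) /\
      F (fraction_graph (hi_num (s k)) (hi_den (s k)))
        <= F (fraction_graph (hi_num (s N.+1)) (hi_den (s N.+1))).
    move=> /nested[lk hk]; have [_ qk] := pos k; have hk2 := hi2 k.
    by split; apply: (spectrum_fraction_le SF) => //; lia.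
  have [m1 m2] := between m mN; have [n1 n2] := between n nN.
  by rewrite ler_norml; lra.
- (* From rank [n + 1] on, the intervals stay away from the number of [H]. *)
  move=> H cvH; have [c [Hc cH]] := decode_surj H.
  pose n := pickle c.
  have xn : x n = fcover_number R H.
    rewrite /x pickleK; apply/eqP.
    by rewrite eq_le !fcover_number_mono.
  have [d d0 dP] : exists2 d, 0 < d & forall m, (n < m)%N ->
      d <= `|fcover_number R (fraction_graph (hi_num (s m)) (hi_den (s m)))
            - fcover_number R H|.
    have E m :
        fcover_number R (fraction_graph (hi_num (s m)) (hi_den (s m))) = hi R (s m).
      by rewrite fcover_number_fraction //; have [] := pos m.
    have := avoiding_sep x n; rewrite -/s xn => -[h|h].
      exists (lo R (s n.+1) - fcover_number R H); first by rewrite subr_gt0.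
      move=> m /nested[l _]; rewrite E; apply: le_trans (ler_norm _).
      by rewrite lerD2r.
    exists (fcover_number R H - hi R (s n.+1)); first by rewrite subr_gt0.
    move=> m /nested[_ l]; rewrite E distrC; apply: le_trans (ler_norm _).
    by rewrite lerD2l lerN2.
  have [M _ MP] := cvgr0_norm_lt _ cvH d d0.
  pose m := maxn M n.+1.
  have := MP m (leq_maxl _ _); apply/negP; rewrite -leNgt.
  apply: le_trans (dP m (leq_maxr _ _)) _.
  by apply: le_trans (spectrum_dist_ge _ _ (fcover_number_spectrum R))
    (ler_norm _).
Qed.
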